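(* The following two statements are equivalent: (1) for every stream $s$, if $\neg\,\mathcal{G}\,(\neg\,\mathcal{G}\,\mathit{blue})\,s$, then the set $\mathcal{R}_s$ of red positions of $s$ is streamless; (2) for every stream $s$, if $\neg\,\mathcal{G}\,\mathit{blue}\,s$, then $\mathcal{F}\,\mathit{red}\,s$ (this is Markov's Principle).
   Context: The equivalence is to be proved constructively (intuitionistic type theory with inductive and coinductive definitions; no excluded middle, no Markov's principle). A color is one of $R$ (red), $B$ (blue). A stream is an element of the coinductive type whose only constructor forms $c\,s$ from a color $c$ and a stream $s$; streams are considered up to bisimilarity (equivalently, functions $\mathbb{N}\to\{R,B\}$ up to pointwise equality). $s@n$ denotes the color of $s$ at position $n$ (positions start at $0$). $\mathit{red}\,s$ means $s=R\,s'$ for some $s'$; $\mathit{blue}\,s$ means $s=B\,s'$ for some $s'$. For a stream predicate $X$: $\mathcal{F}\,X$ is defined inductively by the rules: $X\,s$ implies $\mathcal{F}\,X\,s$; $\mathcal{F}\,X\,s$ implies $\mathcal{F}\,X\,(c\,s)$ for any color $c$. $\mathcal{G}\,X$ is defined coinductively by the rule: $X\,(c\,s)$ and $\mathcal{G}\,X\,s$ imply $\mathcal{G}\,X\,(c\,s)$. Negation is lifted to predicates pointwise: $\neg\,\mathcal{G}\,\mathit{blue}$ inside $\mathcal{G}(\cdot)$ is the predicate $t\mapsto\neg(\mathcal{G}\,\mathit{blue}\,t)$. $\mathcal{R}_s=\{n\in\mathbb{N}\mid s@n=R\}$. For a set $A$, the duplicate-free colists $\mathit{colist}\,A$ over $A$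 are defined coinductively: $\langle\rangle:\mathit{colist}\,A$; and if $x\in A$ and $\ell:\mathit{colist}\,(A\setminus\{x\})$ then $x\,\ell:\mathit{colist}\,A$. Finiteness $\ell\downarrow$ is defined inductively: $\langle\rangle\downarrow$; and $\ell\downarrow$ implies $(x\,\ell)\downarrow$. $A$ is streamless if $\ell\downarrow$ for every $\ell:\mathit{colist}\,A$. *)

(* Defs.v *)
From Stdlib Require Import Streams Ensembles.

(* These notions serve an equivalence between two principles each of which is
   provable with excluded middle: it has content only if proved without
   classical axioms. *)

Inductive color : Set := R | B.

(* [Streams.Exists] and [Streams.ForAll] are the inductive "eventually" and the
   coinductive "always" on stream predicates; their rules speak of [tl x] where
   the informal rules speak of a stream of the form [c s]. *)
Definition F (X : Stream color -> Prop) (s : Stream color) : Prop := Exists X s.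
Definition G (X : Stream color -> Prop) (s : Stream color) : Prop := ForAll X s.

(* Only the head of [s] is constrained (take [s' := tl s]), so Leibniz equality
   of streams and bisimilarity ([EqSt]) give the same predicates. *)
Definition red (s : Stream color) : Prop := exists s', s = Cons R s'.
Definition blue (s : Stream color) : Prop := exists s', s = Cons B s'.

Definition notp (X : Stream color -> Prop) : Stream color -> Prop :=
  fun s => ~ X s.

Definition red_positions (s : Stream color) : Ensemble nat :=
  fun n => Str_nth n s = R.

(* The index shrinks at each step, so an element never occurs twice. *)
CoInductive colist {T : Type} (A : Ensemble T) : Type :=
| conil : colist A
| cocons (x : T) (hx : In T A x) (l : colist (Subtract T A x)) : colist A.

Arguments conil {T A}.
Arguments cocons {T A} x hx l.

Inductive colist_finite {T : Type} : forall {A : Ensemble T}, colist A -> Prop :=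
| conil_finite (A : Ensemble T) : colist_finite (@conil T A)
| cocons_finite (A : Ensemble T) (x : T) (hx : In T A x)
    (l : colist (Subtract T A x)) :
    colist_finite l -> colist_finite (cocons x hx l).

Definition streamless {T : Type} (A : Ensemble T) : Prop :=
  forall l : colist A, colist_finite l.

(* Main.v *)
Require Import Defs.
From Stdlib Require Import List Arith Lia.
From Stdlib Require Import Streams Ensembles.

(** (1) implies (2): given [s] not all blue, let [s'] be red as long as no red
    has occurred in [s], and blue from then on. A red in [s] would make a tail
    of [s'] all blue; so if [s'] had no all-blue tail, [s] would be all blue.
    Hence by (1) the set of red positions of [s'] is streamless. It is an
    initial segment of [nat], and its enumeration in increasing order stops
    only where [s'] turns blue, that is, after a red of [s].

    (2) implies (1): record a colist of red positions of [s] as a stream that is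
    blue until the colist ends and red afterwards. If that stream were all blue,
    the colist would provide arbitrarily many distinct red positions, so no tail
    of [s] would be all blue. Hence Markov's Principle gives the end of the
    colist. *)

(** Trades the modality for a quantifier over positions, on which the later arguments work. *)
Lemma F_iff (X : Stream color -> Prop) (s : Stream color) :
  F X s <-> exists n, X (Str_nth_tl n s).
Proof.
  split.
  - induction 1 as [s HX | s _ [n Hn]].
    + now exists 0.
    + now exists (S n).
  - intros [n Hn]. revert s Hn. induction n as [|n IH]; intros s Hn.
    + now apply Here.
    + now apply Further, IH.
Qed.

Lemma G_iff (X : Stream color -> Prop) (s : Stream color) :
  G X s <-> forall n, X (Str_nth_tl n s).
Proof.
  split.
  - intros H n. revert s H. induction n as [|n IH]; intros s [HX Htl].
    + exact HX.
    + now apply IH.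
  - revert s. cofix IH. intros s H. constructor.
    + exact (H 0).
    + apply IH. intro n. exact (H (S n)).
Qed.

Lemma red_iff (s : Stream color) : red s <-> hd s = R.
Proof.
  split.
  - now intros [s' ->].
  - destruct s as [c s]; cbn; intros ->. now exists s.
Qed.

Lemma blue_iff (s : Stream color) : blue s <-> hd s = B.
Proof.
  split.
  - now intros [s' ->].
  - destruct s as [c s]; cbn; intros ->. now exists s.
Qed.

Lemma F_red_iff (s : Stream color) : F red s <-> exists n, Str_nth n s = R.
Proof.
  rewrite F_iff. split; intros [n Hn]; exists n.
  - exact (proj1 (red_iff _) Hn).
  - exact (proj2 (red_iff _) Hn).
Qed.

Lemma G_blue_iff (s : Stream color) : G blue s <-> forall n, Str_nth n s = B.
Proof.
  rewrite G_iff. split; intros H n.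
  - exact (proj1 (blue_iff _) (H n)).
  - exact (proj2 (blue_iff _) (H n)).
Qed.

Lemma G_blue_tl_iff (n : nat) (s : Stream color) :
  G blue (Str_nth_tl n s) <-> forall m, n <= m -> Str_nth m s = B.
Proof.
  rewrite G_blue_iff. split.
  - intros H m Hm. specialize (H (m - n)). rewrite Str_nth_plus in H.
    now replace (m - n + n) with m in H by lia.
  - intros H m. rewrite Str_nth_plus. apply H. lia.
Qed.

CoFixpoint stream_from {T : Type} (f : nat -> T) (n : nat) : Stream T :=
  Cons (f n) (stream_from f (S n)).

Lemma Str_nth_stream_from {T : Type} (f : nat -> T) (k n : nat) :
  Str_nth k (stream_from f n) = f (k + n).
Proof.
  revert n. induction k as [|k IH]; intro n.
  - reflexivity.
  - change (Str_nth k (stream_from f (S n)) = f (S k + n)).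
    rewrite IH. f_equal. lia.
Qed.

(** [R] if [l] has at most [k] elements, and [B] otherwise. *)
Fixpoint ended {T : Type} (k : nat) {A : Ensemble T} (l : colist A) : color :=
  match l with
  | conil => R
  | cocons _ _ l' => match k with 0 => B | S k' => ended k' l' end
  end.

(** Turns finiteness into the occurrence of a red, the conclusion that Markov's Principle yields. *)
Lemma colist_finite_iff {T : Type} {A : Ensemble T} (l : colist A) :
  colist_finite l <-> exists k, ended k l = R.
Proof.
  split.
  - induction 1 as [A | A x hx l _ [k Hk]].
    + now exists 0.
    + now exists (S k).
  - intros [k Hk]. revert A l Hk.
    induction k as [|k IH]; intros A [|x hx l] Hk; cbn in Hk.
    + constructor.
    + discriminate.
    + constructor.
    + constructor. now apply IH.
Qed.

Lemma not_ended_NoDup {T : Type} (k : nat) (A : Ensemble T) (l : colist A) :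
  ended k l = B ->
  exists xs, NoDup xs /\ length xs = S k /\ forall x, List.In x xs -> In T A x.
Proof.
  revert A l. induction k as [|k IH]; intros A [|x hx l]; cbn; intro Hk;
    try discriminate.
  - exists (x :: nil). split; [|split].
    + repeat constructor. intros [].
    + reflexivity.
    + now intros y [<-|[]].
  - destruct (IH _ _ Hk) as (xs & Hnd & Hlen & Hin).
    exists (x :: xs). split; [|split].
    + constructor; [|exact Hnd].
      (* The members of [xs] lie in the index of the tail, from which [x] is subtracted. *)
      intro Hx. apply Hin in Hx as [_ Hx]. apply Hx. constructor.
    + cbn. now rewrite Hlen.
    + intros y [<-|Hy]; [exact hx|]. now apply Hin in Hy as [Hy _].
Qed.

(** Pigeonhole: otherwise [l] yields [n + 1] distinct numbers below [n]. *)
Lemma ended_of_bounded (n : nat) (A : Ensemble nat) (l : colist A) :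
  (forall m, In nat A m -> m < n) -> ended n l = R.
Proof.
  intro Hb. destruct (ended n l) eqn:E; [reflexivity|exfalso].
  apply not_ended_NoDup in E as (xs & Hnd & Hlen & Hin).
  assert (Hle : length xs <= length (seq 0 n)).
  { apply NoDup_incl_length; [exact Hnd|].
    intros m Hm. apply in_seq. apply Hin, Hb in Hm. lia. }
  rewrite length_seq in Hle. lia.
Qed.

(** The stream [s'] of the outline. Position [n] is inspected too, so the change to blue occurs
    exactly at the first red. *)
Fixpoint before_red (f : nat -> color) (n : nat) : color :=
  match f n with
  | R => B
  | B => match n with 0 => R | S m => before_red f m end
  end.

Lemma before_red_blue_iff (f : nat -> color) (n : nat) :
  before_red f n = B <-> exists m, m <= n /\ f m = R.
Proof.
  induction n as [|n IH]; cbn.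
  - destruct (f 0) eqn:E; split.
    + intros _. now exists 0.
    + reflexivity.
    + discriminate.
    + intros (m & Hm & Hf). replace m with 0 in Hf by lia. congruence.
  - destruct (f (S n)) eqn:E; [|rewrite IH]; split.
    + intros _. now exists (S n).
    + reflexivity.
    + intros (m & Hm & Hf). exists m. split; [lia|exact Hf].
    + intros (m & Hm & Hf). exists m. split; [|exact Hf].
      destruct (Nat.eq_dec m (S n)) as [->|]; [congruence|lia].
Qed.

(** Side condition of the corecursive call in [red_run]. *)
Lemma In_Subtract_above (n : nat) (A P : Ensemble nat) :
  (forall m, n <= m -> P m -> In nat A m) ->
  forall m, S n <= m -> P m -> In nat (Subtract nat A n) m.
Proof.
  intros H m Hm HP. split.
  - apply H; [lia|exact HP].
  - intro Hn. destruct Hn. lia.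
Qed.

(** Lists [n, n+1, ...] up to the first [m >= n] with [f m = B]. Generalizing
    over [A] lets the recursive call absorb the successive [Subtract]s. *)
CoFixpoint red_run (f : nat -> color) (n : nat) (A : Ensemble nat)
    (H : forall m, n <= m -> f m = R -> In nat A m) : colist A :=
  match f n as c return f n = c -> colist A with
  | R => fun E => cocons n (H n (le_n n) E)
           (red_run f (S n) (Subtract nat A n)
              (In_Subtract_above n A (fun m => f m = R) H))
  | B => fun _ => conil
  end eq_refl.

Lemma ended_red_run (f : nat -> color) (k n : nat) (A : Ensemble nat)
    (H : forall m, n <= m -> f m = R -> In nat A m) :
  ended k (red_run f n A H) = R -> exists m, f m = B.
Proof.
  revert n A H. induction k as [|k IH]; intros n A H; cbn;
    (* The type of [H n (le_n n)] mentions [f n]; generalizing it keeps the case split well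
       typed. *)
    generalize (H n (le_n n)); destruct (f n) eqn:E; cbn; intros h Hk.
  - discriminate.
  - now exists n.
  - exact (IH _ _ _ Hk).
  - now exists n.
Qed.

Lemma streamless_red_has_blue (s : Stream color) :
  streamless (red_positions s) -> exists n, Str_nth n s = B.
Proof.
  intro Hs.
  pose (l := red_run (fun n => Str_nth n s) 0 (red_positions s)
               (fun m _ Hm => Hm)).
  destruct (proj1 (colist_finite_iff l) (Hs l)) as [k Hk].
  exact (ended_red_run (fun n => Str_nth n s) k 0 _ _ Hk).
Qed.

Theorem lemma4p10 :
  (forall s : Stream color,
     ~ G (notp (G blue)) s -> streamless (red_positions s))
  <->
  (forall s : Stream color, ~ G blue s -> F red s).
Proof.
  split.
  - intros H1 s Hs.
    pose (f := fun n => Str_nth n s).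
    assert (Hnth : forall n,
              Str_nth n (stream_from (before_red f) 0) = before_red f n).
    { intro n. now rewrite Str_nth_stream_from, Nat.add_0_r. }
    assert (Hsl : streamless (red_positions (stream_from (before_red f) 0))).
    { apply H1. intro HG. apply Hs, G_blue_iff. intro n.
      destruct (Str_nth n s) eqn:E; [exfalso|reflexivity].
      apply (proj1 (G_iff _ _) HG n), G_blue_tl_iff. intros m Hm.
      rewrite Hnth. apply before_red_blue_iff. now exists n. }
    apply streamless_red_has_blue in Hsl as [n Hn].
    rewrite Hnth in Hn. apply before_red_blue_iff in Hn as (m & _ & Hm).
    apply F_red_iff. now exists m.
  - intros MP s Hs l.
    pose (t := stream_from (fun k => ended k l) 0).
    assert (Hnth : forall k, Str_nth k t = ended k l).
    { intro k. unfold t. now rewrite Str_nth_stream_from, Nat.add_0_r. }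
    assert (Ht : F red t).
    { apply MP. intro Hb. apply Hs, G_iff. intros n Hn.
      (* As [s] is blue from [n] on, its red positions lie below [n], so [l] has at most [n]
         elements and [t] is red at [n]. *)
      assert (Hend : ended n l = R).
      { apply ended_of_bounded. intros m Hm.
        destruct (Nat.lt_ge_cases m n) as [Hlt|Hge]; [exact Hlt|exfalso].
        apply (proj1 (G_blue_tl_iff n s) Hn) in Hge.
        unfold In, red_positions in Hm. congruence. }
      apply (proj1 (G_blue_iff t)) with (n := n) in Hb.
      rewrite Hnth in Hb. congruence. }
    apply F_red_iff in Ht as [k Hk]. rewrite Hnth in Hk.
    apply colist_finite_iff. now exists k.
Qed.
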